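(* For all integers $1\le d\le n$, the numbers $S^{(d)}_n$ of $d$-admissible chord diagrams in an $(n+3)$-gon satisfy the recurrence relation $$S^{(d)}_n=2S^{(d)}_{n-1}+\sum_{k=1}^{d-1}C_k\,S^{(d)}_{n-k-1}.$$
   Context: $C_k=\frac{1}{k+1}\binom{2k}{k}$ is the $k$-th Catalan number. Consider a convex $(n+3)$-gon with vertices $1,\dots,n+3$ in cyclic order; a chord $\overline{ab}$ joins two non-adjacent vertices. For $d\ge 1$, the set $\mathcal Ch_d$ of $d$-chords consists of: $\overline{1i}$ for $3\le i\le n+2$; $\overline{j(n+3)}$ for $2\le j\le n+1$; and $\overline{ij}$ for $2\le i<j\le n+2$ with $2\le j-i\le d$. Two $d$-chords are $d$-compatible if either they do not cross, or they are of the form $\overline{1j}$ and $\overline{i(n+3)}$ with $2\le i<j\le n+2$ and $j-i\ge d+1$. A $d$-admissible chord diagram is a maximal collection of pairwise $d$-compatible $d$-chords. $S^{(d)}_n$ is the number of $d$-admissible chord diagrams in the $(n+3)$-gon; the same definition is used when $d>n\ge1$, and $S^{(d)}_0=1$. *)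

(* Defs.v *)
From mathcomp Require Import all_boot.

Set Implicit Arguments.
Unset Strict Implicit.
Unset Printing Implicit Defensive.

Definition catalan (k : nat) : nat := 'C(k.*2, k) %/ k.+1.

(* The truncated quotient above is exact. *)
Lemma catalanE k : k.+1 * catalan k = 'C(k.*2, k).
Proof.
rewrite mulnC /catalan divnK //.
have h : k.+1 * 'C(k.*2, k.+1) = k * 'C(k.*2, k).
  by rewrite mul_bin_left -addnn addnK.
rewrite -(@Gauss_dvdr _ k); last exact: coprimeSn.
by rewrite -h dvdn_mulr.
Qed.

(* The vertices 1, ..., n+3 of the polygon are the ordinals 0, ..., n+2. *)
Definition label n (v : 'I_n.+3) : nat := v.+1.

(* A segment ab with a < b is the pair (a, b). *)
Definition segment n := ('I_n.+3 * 'I_n.+3)%type.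

Definition dchords (d n : nat) : {set segment n} :=
  [set c : segment n |
     let a := label c.1 in let b := label c.2 in
     [|| (a == 1) && (3 <= b <= n + 2),
         (b == n + 3) && (2 <= a <= n + 1)
       | [&& 2 <= a, a < b, b <= n + 2 & 2 <= b - a <= d]]].

(* Segments of a convex polygon cross (in their interiors) exactly when their
   four endpoints are distinct and alternate in the cyclic order. *)
Definition cross n (c e : segment n) : bool :=
  [&& label c.1 < label e.1, label e.1 < label c.2 & label c.2 < label e.2]
  || [&& label e.1 < label c.1, label c.1 < label e.2 & label e.2 < label c.2].

(* c = 1j and e = i(n+3), with 2 <= i < j <= n+2 and j - i >= d+1. *)
Definition far_pair (d n : nat) (c e : segment n) : bool :=
  let j := label c.2 in let i := label e.1 in
  [&& label c.1 == 1, label e.2 == n + 3,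
      2 <= i, i < j, j <= n + 2 & d + 1 <= j - i].

Definition dcompatible (d n : nat) (c e : segment n) : bool :=
  [|| ~~ cross c e, far_pair d c e | far_pair d e c].

Definition compatible_collection (d n : nat) (D : {set segment n}) : bool :=
  (D \subset dchords d n) && [forall c in D, forall e in D, dcompatible d c e].

Definition admissible_diagrams (d n : nat) : {set {set segment n}} :=
  [set D | maxset (@compatible_collection d n) D].

Definition S_num (d n : nat) : nat :=
  if n is 0 then 1 else #|admissible_diagrams d n|.

(* Main.v *)
Require Import Defs.
From mathcomp Require Import all_boot.
From mathcomp Require Import zify.

Set Implicit Arguments.
Unset Strict Implicit.
Unset Printing Implicit Defensive.

(** Vertices are numbered from 0 here, so that [0] and [n+2] are the two apexes
    and a chord is a pair [(a, b)] with [a < b].  Diagrams are the facets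
    (maximal cliques) of the flag complex of d-chords; write [X(d,n)] for it.

    Take a facet [D] and consider the vertex [1], the neighbour of the apex [0].
    Exactly one of the following holds ([facet_cases]).
    - The chord [(1, n+2)] lies in [D].
    - There is one [k < min(d, n)] such that [(0, k+2)] and [(1, k+2)] lie in
      [D], where [(1, 2)] counts as a side for [k = 0].  Here [k+2] is the far
      end of the longest segment at [1] that stays among the vertices [1..n+1]:
      every chord in conflict with [(0, k+2)] either is [(1, n+2)], or is a
      longer segment at [1], or crosses [(1, k+2)]; maximality therefore puts
      [(0, k+2)] in [D].

    The facets containing a given clique are the facets of its link.
    - The link of [(1, n+2)] is a copy of [X(d,n-1)]: the vertex [1] disappears,
      and a chord [(0, b)] of the smaller complex becomes either the inner chord
      [(1, b+1)], when [b <= d], or the chord [(0, b+1)], when [b > d].  These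
      are exactly the chords compatible with [(1, n+2)], and the copy preserves
      compatibility: a chord [(0, b)] with [b <= d] conflicts with every
      chord that crosses it, just as an inner chord does
      ([card_facets_right_chord]).
    - The link of [(0, k+2), (1, k+2)] is a join: the chords strictly under
      [(1, k+2)] triangulate a polygon with [k+2] sides, and the chords beyond
      it form a copy of [X(d,n-k-1)] ([card_facets_wedge]).

    Counting gives [S_n = S_(n-1) + sum_(k < min(d,n)) t_k S_(n-1-k)], with
    [t_0 = 1] and [t_(k+1) = S_k] ([S_num_rec]).  For [n <= d] this is the
    Catalan convolution, so [S_n] is the Catalan number of index [n+1] there and
    every [t_k] that occurs is the k-th Catalan number; substituting this back
    for [n >= d] is the claimed recurrence. *)

(** * Catalan numbers *)

Lemma catalanS k : k.+2 * catalan k.+1 = (4 * k + 2) * catalan k.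
Proof.
apply/eqP; rewrite -(eqn_pmul2l (ltn0Sn k)); apply/eqP.
rewrite catalanE [RHS]mulnCA catalanE doubleS -mul_bin_diag /=.
have <- : 'C(k.*2.+1, k.+1) = 'C(k.*2.+1, k).
  by rewrite -bin_sub -?addnn; [congr 'C(_, _)|]; lia.
by have := mul_bin_diag k.*2.+1 k; rewrite /=; nia.
Qed.

(** With [T n] the left-hand side, the symmetry [k <-> n - k] turns the weight
    [k + 1] into [(n + 2) / 2]; combined with the two-term recurrence this gives
    [(n + 3) T (n+1) = 2 C (n+1) + 4 (n+1) T n], which determines [T]. *)
Lemma catalan_convolution n :
  \sum_(k < n.+1) catalan k * catalan (n - k) = catalan n.+1.
Proof.
elim: n => [|n IHn]; first by rewrite big_ord_recl big_ord0.
pose T m := \sum_(k < m.+1) catalan k * catalan (m - k).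
have symT m : 2 * (\sum_(k < m.+1) k.+1 * (catalan k * catalan (m - k)))
              = m.+2 * T m.
  rewrite mul2n -addnn {1}(reindex_inj rev_ord_inj) /= -big_split big_distrr /=.
  apply: eq_bigr => i _; have := ltn_ord i => ltim.
  rewrite subSS subKn // (mulnC (catalan (m - i))) -mulnDl.
  by congr (_ * _); lia.
apply/eqP; rewrite -(eqn_pmul2l (ltn0Sn n.+2)); apply/eqP.
rewrite -/(T n.+1) -symT catalanS big_ord_recl /=.
have -> : \sum_(i < n.+1) (lift ord0 i).+1 *
   (catalan (lift ord0 i) * catalan (n.+1 - lift ord0 i)) =
   \sum_(i < n.+1) (4 * i + 2) * (catalan i * catalan (n - i)).
  by apply: eq_bigr => i _; rewrite /= /bump /= add1n subSS !mulnA catalanS.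
have : \sum_(i < n.+1) (4 * i + 2) * (catalan i * catalan (n - i)) + 2 * T n
  = 4 * \sum_(k < n.+1) k.+1 * (catalan k * catalan (n - k)).
  rewrite !big_distrr -big_split /=; apply: eq_bigr => i _.
  by rewrite mulnA; lia.
have := symT n; rewrite /T IHn.
have -> : catalan 0 = 1 by [].
rewrite subn0; lia.
Qed.

(** * Facets of flag complexes *)

Section Facets.

Variables (T : finType) (r : rel T).

Definition clique (A D : {set T}) : bool :=
  (D \subset A) && [forall x in D, forall y in D, r x y].

Definition facets (A : {set T}) : {set {set T}} := [set D | maxset (clique A) D].

Definition link (s A : {set T}) : {set T} :=
  [set x in A :\: s | [forall y in s, r x y]].

Lemma cliqueP (A D : {set T}) :
  reflect (D \subset A /\ {in D &, forall x y, r x y}) (clique A D).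
Proof.
apply: (iffP andP) => -[sDA cD]; split=> //.
  by move=> x y Dx Dy; apply: (implyP (forallP (implyP (forallP cD x) Dx) y) Dy).
by apply/forall_inP => x Dx; apply/forall_inP => y; apply: cD.
Qed.

Hypotheses (r_refl : reflexive r) (r_sym : symmetric r).

Lemma facetsP (A D : {set T}) :
  reflect [/\ D \subset A, {in D &, forall x y, r x y}
            & forall x, x \in A -> {in D, forall y, r x y} -> x \in D]
          (D \in facets A).
Proof.
rewrite inE; apply: (iffP maxsetP) => [[/cliqueP[sDA cD] maxD] | [sDA cD maxD]].
  split=> // x Ax rx.
  suff <- : x |: D = D by rewrite setU11.
  apply: maxD; last exact: subsetUr.
  apply/cliqueP; split; first by rewrite subUset sub1set Ax.
  move=> y z /setU1P[->|Dy] /setU1P[->|Dz]; first exact: r_refl.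
  - exact: rx.
  - by rewrite r_sym; apply: rx.
  - exact: cD.
split=> [|B /cliqueP[sBA cB] sDB]; first by apply/cliqueP.
apply/eqP; rewrite eqEsubset sDB andbT; apply/subsetP => x Bx.
apply: maxD => [|y Dy]; first exact: (subsetP sBA).
by apply: cB => //; apply: (subsetP sDB).
Qed.

(** The complex with no vertices still has the empty facet. *)
Lemma card_facets0 : #|facets set0| = 1.
Proof.
apply/eqP/cards1P; exists set0; apply/setP => D; rewrite [RHS]inE.
apply/facetsP/eqP => [[]|->]; first by rewrite subset0 => /eqP.
by split=> // x; rewrite inE.
Qed.

(** Removing [s] from a facet through [s] and adding it back are inverse. *)
Lemma card_facets_link (s A : {set T}) : clique A s ->
  #|[set D in facets A | s \subset D]| = #|facets (link s A)|.
Proof.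
move=> /cliqueP[sA cs].
have linkD E x : E \in facets (link s A) -> x \in E -> x \notin s.
  by case/facetsP => sE _ _ /(subsetP sE); rewrite !inE => /andP[/andP[]].
rewrite -[RHS](card_in_imset (f := setU s)) => [|D E fD fE eqDE]; last first.
  apply/setP => x; have := congr1 (fun B : {set T} => x \in B) eqDE.
  rewrite !inE; case: (boolP (x \in s)) => //= sx _.
  by apply/idP/idP => [/(linkD _ _ fD)|/(linkD _ _ fE)]; rewrite sx.
apply: eq_card => D; rewrite inE.
apply/andP/imsetP => [[/facetsP[sDA cD maxD] sD] | [E fE ->]].
  exists (D :\: s); last first.
    apply/setP => x; rewrite !inE; case: (boolP (x \in s)) => //= sx.
    exact: (subsetP sD).
  apply/facetsP; split.
  - apply/subsetP => x; rewrite !inE => /andP[-> Dx]; rewrite (subsetP sDA) //=.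
    by apply/forall_inP => y sy; apply: cD => //; apply: (subsetP sD).
  - by move=> x y /setDP[Dx _] /setDP[Dy _]; apply: cD.
  move=> x; rewrite !inE => /andP[/andP[nsx Ax] /forall_inP rx] rxD.
  rewrite nsx; apply: maxD => // y Dy; case: (boolP (y \in s)) => [/rx //|nsy].
  by apply: rxD; rewrite !inE nsy.
split; last exact: subsetUl.
case/facetsP: fE => sE cE maxE.
have inE' x : x \in E -> [/\ x \in A, x \notin s & {in s, forall y, r x y}].
  by move/(subsetP sE); rewrite !inE => /andP[/andP[-> ->] /forall_inP].
apply/facetsP; split.
- by rewrite subUset sA; apply/subsetP => x /inE'[].
- move=> x y /setUP[sx|Ex] /setUP[sy|Ey].
  + exact: cs.
  + by rewrite r_sym; have [_ _] := inE' y Ey; apply.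
  + by have [_ _] := inE' x Ex; apply.
  + exact: cE.
move=> x Ax rx; rewrite inE; case: (boolP (x \in s)) => //= nsx.
apply: maxE => [|y Ey]; last by apply: rx; rewrite inE Ey orbT.
rewrite !inE nsx Ax /=; apply/forall_inP => y sy.
by apply: rx; rewrite inE sy.
Qed.

(** Between [A] and [B] nothing conflicts, so a facet of the union is a free
    choice of a facet on each side. *)
Lemma card_facets_join (A B : {set T}) : [disjoint A & B] ->
    (forall x y, x \in A -> y \in B -> r x y) ->
  #|facets (A :|: B)| = #|facets A| * #|facets B|.
Proof.
move=> dAB rAB; rewrite -cardsX.
have sub1 D E : D \in facets A -> E \in facets B -> (D :|: E) :&: A = D.
  case/facetsP => sD _ _ /facetsP[sE _ _]; rewrite setIUl (setIidPl sD).
  apply/setUidPl; rewrite (_ : E :&: A = set0) ?sub0set //.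
  apply/eqP; rewrite setI_eq0 disjoint_sym; exact: disjointWr sE dAB.
have sub2 D E : D \in facets A -> E \in facets B -> (D :|: E) :&: B = E.
  case/facetsP => sD _ _ /facetsP[sE _ _]; rewrite setIUl (setIidPl sE).
  apply/setUidPr; rewrite (_ : D :&: B = set0) ?sub0set //.
  apply/eqP; rewrite setI_eq0; exact: disjointWl sD dAB.
rewrite -[RHS](card_in_imset (f := fun p : {set T} * {set T} => p.1 :|: p.2)); last first.
  move=> p q; case: p => D E; case: q => D' E' /setXP[/= fD fE] /setXP[/= fD' fE'] eqU.
  by congr pair; [rewrite -(sub1 _ _ fD fE) eqU sub1 | rewrite -(sub2 _ _ fD fE) eqU sub2].
apply: eq_card => D; apply/idP/imsetP => [/facetsP[sD cD maxD] | [[E F]]].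
  exists (D :&: A, D :&: B); last by rewrite /= -setIUr (setIidPl sD).
  apply/setXP; split; apply/facetsP; split=> /=; rewrite ?subsetIr //.
  - by move=> x y /setIP[Dx _] /setIP[Dy _]; apply: cD.
  - move=> x Ax rx; rewrite inE Ax andbT; apply: maxD => [|y Dy].
      by rewrite inE Ax.
    have /setUP[Ay|By] := subsetP sD y Dy; last exact: rAB.
    by apply: rx; rewrite inE Dy.
  - by move=> x y /setIP[Dx _] /setIP[Dy _]; apply: cD.
  - move=> x Bx rx; rewrite inE Bx andbT; apply: maxD => [|y Dy].
      by rewrite inE Bx orbT.
    have /setUP[Ay|By] := subsetP sD y Dy; first by rewrite r_sym; apply: rAB.
    by apply: rx; rewrite inE Dy.
case/setXP => /= /facetsP[sE cE maxE] /facetsP[sF cF maxF] ->.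
apply/facetsP; split; first exact: setUSS.
  move=> x y /setUP[Ex|Fx] /setUP[Ey|Fy].
  + exact: cE.
  + by apply: rAB; [apply: (subsetP sE)|apply: (subsetP sF)].
  + by rewrite r_sym; apply: rAB; [apply: (subsetP sE)|apply: (subsetP sF)].
  + exact: cF.
move=> x /setUP[Ax|Bx] rx; rewrite inE.
  by rewrite maxE // => y Ey; apply: rx; rewrite inE Ey.
by rewrite maxF ?orbT // => y Fy; apply: rx; rewrite inE Fy orbT.
Qed.

End Facets.

Lemma card_facets_iso (T U : finType) (r : rel T) (q : rel U)
    (A : {set T}) (B : {set U}) (f : T -> U) (h : U -> T) :
    reflexive r -> symmetric r -> reflexive q -> symmetric q ->
    (forall x, x \in A -> f x \in B /\ h (f x) = x) ->
    (forall y, y \in B -> h y \in A /\ f (h y) = y) ->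
    {in A &, forall x y, r x y = q (f x) (f y)} ->
  #|facets r A| = #|facets q B|.
Proof.
move=> rr rs qr qs fP hP rq.
have injf : {in A &, injective f}.
  by move=> x y /fP[_ fx] /fP[_ fy] e; rewrite -fx -fy e.
rewrite -(card_in_imset (f := fun D : {set T} => f @: D)) => [|D E]; last first.
  move=> /facetsP[]// sD _ _ /facetsP[]// sE _ _ e.
  have K (F : {set T}) : F \subset A -> h @: (f @: F) = F.
    move=> sF; rewrite -imset_comp -[RHS]imset_id; apply: eq_in_imset => x Fx /=.
    by have [] := fP x (subsetP sF x Fx).
  by rewrite -(K D) // e K.
apply: eq_card => E; apply/imsetP/idP => [[D /facetsP[]// sD cD maxD ->]|].
  apply/facetsP => //; split.
  - by apply/subsetP => _ /imsetP[x Dx ->]; have [] := fP x (subsetP sD x Dx).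
  - move=> _ _ /imsetP[x Dx ->] /imsetP[y Dy ->].
    by rewrite -rq ?(subsetP sD) //; apply: cD.
  move=> y By ry; have [Ah <-] := hP y By; apply: imset_f; apply: maxD => // x Dx.
  have Ax := subsetP sD x Dx; rewrite rq //; have [_ ->] := hP y By.
  by apply: ry; apply: imset_f.
case/facetsP => // sE cE maxE; exists (h @: E); last first.
  rewrite -imset_comp -[LHS]imset_id; apply: eq_in_imset => y Ey /=.
  by have [] := hP y (subsetP sE y Ey).
have hE y : y \in E -> h y \in A /\ f (h y) = y by move/(subsetP sE)/hP.
apply/facetsP => //; split.
- by apply/subsetP => _ /imsetP[y Ey ->]; have [] := hE y Ey.
- move=> _ _ /imsetP[x Ex ->] /imsetP[y Ey ->].
  have [Ax fx] := hE x Ex; have [Ay fy] := hE y Ey.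
  by rewrite rq // fx fy; apply: cE.
move=> x Ax rx; have [Bf <-] := fP x Ax; apply: imset_f; apply: maxE => // y Ey.
have [Ay fy] := hE y Ey; rewrite -fy -rq //; apply: rx; exact: imset_f.
Qed.

(** * Chords by the numbers of their end points *)

Lemma dcompatible_refl d n : reflexive (@dcompatible d n).
Proof. by move=> c; rewrite /dcompatible /cross !ltnn. Qed.

Lemma dcompatible_sym d n : symmetric (@dcompatible d n).
Proof.
move=> c e; rewrite /dcompatible [far_pair d c e || _]orbC.
by rewrite /cross [X in ~~ X]orbC.
Qed.

Lemma S_numE d n : S_num d n = #|facets (@dcompatible d n) (dchords d n)|.
Proof.
case: n => // ; rewrite (_ : dchords d 0 = set0) ?card_facets0 //.
- exact: dcompatible_refl.
- exact: dcompatible_sym.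
apply/setP => -[a b]; rewrite !inE /label /=; lia.
Qed.

Definition seg n (a b : nat) : segment n := (inord a, inord b).

Lemma seg_val n (c : segment n) a b : c.1 = a :> nat -> c.2 = b :> nat -> seg n a b = c.
Proof. by case: c => x y /= <- <-; rewrite /seg !inord_val. Qed.

Definition is_dchord (d n a b : nat) : bool :=
  [|| (a == 0) && (2 <= b <= n.+1), (b == n.+2) && (1 <= a <= n)
    | [&& 1 <= a, b <= n.+1 & a.+2 <= b <= a + d]].

(** An incompatible crossing, oriented so that [(a, b)] starts first.  The last
    clause excludes the tolerated crossings of [(0, b)] with [(x, n+2)], those
    where [b - x] exceeds [d]. *)
Definition clash (d n a b x y : nat) : bool :=
  [&& a < x, x < b, b < y & [|| 0 < a, y < n.+2 | b <= x + d]].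

Arguments is_dchord : simpl never.
Arguments clash : simpl never.

Lemma in_dchords d n (c : segment n) : (c \in dchords d n) = is_dchord d n c.1 c.2.
Proof. rewrite inE /label /is_dchord; lia. Qed.

Lemma dcompatibleE d n (c e : segment n) :
  dcompatible d c e = ~~ (clash d n c.1 c.2 e.1 e.2 || clash d n e.1 e.2 c.1 c.2).
Proof.
case: c e => [a b] [x y]; rewrite /dcompatible /cross /far_pair /clash /label /=.
have := ltn_ord a; have := ltn_ord b; have := ltn_ord x; have := ltn_ord y.
lia.
Qed.

(** The map [(a, b) |-> (f1 a b, b + s)] relabels the chords of a smaller polygon
    as the chords of a larger one selected by [P]; [h1] recovers the first end
    point.  Every relabelling needed is a plain shift on second end points. *)
Lemma card_facets_relabel d m n (P : nat -> nat -> bool) (f1 h1 : nat -> nat -> nat)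
    (s : nat) :
    (forall a b, is_dchord d m a b ->
      [/\ is_dchord d n (f1 a b) (b + s), P (f1 a b) (b + s)
        & h1 (f1 a b) (b + s) = a]) ->
    (forall a b, is_dchord d n a b -> P a b ->
      [/\ is_dchord d m (h1 a b) (b - s), f1 (h1 a b) (b - s) = a & s <= b]) ->
    (forall a b x y, is_dchord d m a b -> is_dchord d m x y ->
      clash d m a b x y = clash d n (f1 a b) (b + s) (f1 x y) (y + s)) ->
  #|facets (@dcompatible d n) [set c : segment n | is_dchord d n c.1 c.2 && P c.1 c.2]|
  = S_num d m.
Proof.
move=> fP hP cP; rewrite S_numE.
have bnd k a b : is_dchord d k a b -> a < k.+3 /\ b < k.+3.
  by rewrite /is_dchord; lia.
symmetry.
apply: (@card_facets_iso _ _ _ _ _ _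
  (fun c : segment m => seg n (f1 c.1 c.2) (c.2 + s))
  (fun c : segment n => seg m (h1 c.1 c.2) (c.2 - s))).
- exact: dcompatible_refl.
- exact: dcompatible_sym.
- exact: dcompatible_refl.
- exact: dcompatible_sym.
- move=> c; rewrite in_dchords => /fP[h q e]; have [b1 b2] := bnd _ _ _ h.
  rewrite inE /seg /= !inordK // h q; split=> //.
  by apply: seg_val; rewrite // addnK.
- move=> c; rewrite inE => /andP[h q]; have [{}h e le_s] := hP _ _ h q.
  have [b1 b2] := bnd _ _ _ h.
  rewrite in_dchords /seg /= !inordK // h; split=> //.
  by apply: seg_val; rewrite // subnK.
move=> c e; rewrite !in_dchords => hc he; rewrite !dcompatibleE.
have [/bnd[? ?] _ _] := fP _ _ hc; have [/bnd[? ?] _ _] := fP _ _ he.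
by rewrite /seg /= !inordK // -!cP.
Qed.

Lemma eq_seg n (c : segment n) a b : a < n.+3 -> b < n.+3 ->
  (c == seg n a b) = (c.1 == a :> nat) && (c.2 == b :> nat).
Proof.
by case: c => x y lta ltb; rewrite /seg xpair_eqE -!val_eqE /= !inordK.
Qed.

(** * The facets through the chord from vertex 1 to the far apex *)

Definition right_chord n : segment n := seg n 1 n.+2.

Lemma right_chord_dchord d n : 0 < n -> right_chord n \in dchords d n.
Proof. by move=> n0; rewrite in_dchords /seg /= !inordK // /is_dchord; lia. Qed.

(** A chord [(0, b)] with [b <= d + 1] is incompatible with [(1, n+2)], so
    among the chords [(0, _)] only the long ones survive in the link; the inner
    chords [(1, _)], of length at most [d], replace the short ones. *)
Lemma card_facets_right_chord d n : 0 < d -> 0 < n ->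
  #|[set D in facets (@dcompatible d n) (dchords d n) | right_chord n \in D]|
  = S_num d n.-1.
Proof.
move=> d0 n0.
have cl : clique (@dcompatible d n) (dchords d n) [set right_chord n].
  apply/cliqueP; split; first by rewrite sub1set right_chord_dchord.
  by move=> x y /set1P-> /set1P->; apply: dcompatible_refl.
have := card_facets_link (@dcompatible_refl d n) (@dcompatible_sym d n) cl.
have -> : [set D in facets (@dcompatible d n) (dchords d n) | [set right_chord n] \subset D]
        = [set D in facets (@dcompatible d n) (dchords d n) | right_chord n \in D].
  by apply/setP => D; rewrite [LHS]inE [RHS]inE sub1set.
move=> ->.
pose P a b := ~~ ((a == 1) && (b == n.+2)) && ~~ ((a == 0) && (b <= d.+1)).
rewrite -(@card_facets_relabel d n.-1 n P
  (fun a b => if (a == 0) && (d < b) then 0 else a.+1) (fun a _ => a.-1) 1).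
- congr #|pred_of_set (facets _ _)|; apply/setP => c; rewrite [LHS]inE [RHS]inE in_setD in_set1.
  rewrite in_dchords eq_seg //.
  have -> : [forall y in [set right_chord n], dcompatible d c y]
           = dcompatible d c (right_chord n).
    by apply/forall_inP/idP => [|h y /set1P-> //]; apply; rewrite inE.
  rewrite dcompatibleE /seg /= !inordK // /P /is_dchord /clash; lia.
- move=> a b; rewrite /is_dchord /P /=; case: ifP; split; lia.
- move=> a b; rewrite /is_dchord /P /=; case: ifP; split; lia.
- move=> a b x y; rewrite /is_dchord /clash /=; case: ifP; case: ifP; lia.
Qed.

(** * The facets through a wedge over the side from vertex 1 to apex 0 *)

(** The chords [(0, k+2)] and [(1, k+2)].  Intersecting with the d-chords drops
    the second one when [k = 0], where it is a side of the polygon. *)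
Definition wedge d n k : {set segment n} :=
  [set c in dchords d n | (c.1 <= 1) && (c.2 == k.+2 :> nat)].

Lemma in_wedge d n k (c : segment n) :
  (c \in wedge d n k) = [&& is_dchord d n c.1 c.2, c.1 <= 1 & c.2 == k.+2 :> nat].
Proof. by rewrite in_set in_dchords. Qed.

(** The number of triangulations of the polygon with vertices
    [1, ..., k+2], when [k < d]. *)
Definition ear_count d k := if k is k'.+1 then S_num d k' else 1.

(** Nothing under [(1, k+2)] conflicts with anything beyond the wedge.  The part
    under it is the complex of a polygon with parameter [k-1 < d], which has
    every diagonal as a chord and no tolerated crossing; in the part beyond, the
    wedge collapses to a side and [k+2] becomes the new vertex 1. *)
Lemma card_facets_wedge d n k : k < d -> k < n ->
  #|[set D in facets (@dcompatible d n) (dchords d n) | wedge d n k \subset D]|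
  = ear_count d k * S_num d (n - k.+1).
Proof.
move=> kd kn; have ltk : k.+2 < n.+3 by lia.
have cl : clique (@dcompatible d n) (dchords d n) (wedge d n k).
  apply/cliqueP; split; first by apply/subsetP => c; rewrite inE => /andP[].
  move=> x y; rewrite !in_wedge dcompatibleE /is_dchord /clash; lia.
rewrite (card_facets_link (@dcompatible_refl d n) (@dcompatible_sym d n) cl).
pose P a b := [&& 1 <= a, b <= k.+2 & ~~ ((a == 1) && (b == k.+2))].
pose Q a b := ((a == 0) || (k.+2 <= a)) && (k.+3 <= b).
pose A := [set c : segment n | is_dchord d n c.1 c.2 && P c.1 c.2].
pose B := [set c : segment n | is_dchord d n c.1 c.2 && Q c.1 c.2].
have -> : link (@dcompatible d n) (wedge d n k) (dchords d n) = A :|: B.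
  apply/setP => c; rewrite [LHS]inE [RHS]in_setU in_setD in_wedge in_dchords /A /B !in_set.
  apply/andP/idP => [[cs /forall_inP h] | cAB].
    have h0 : ~~ (clash d n c.1 c.2 0 k.+2 || clash d n 0 k.+2 c.1 c.2).
      have := h (seg n 0 k.+2).
      rewrite in_wedge dcompatibleE /seg /= !inordK //; apply.
      by rewrite /is_dchord; lia.
    have h1 : 0 < k -> ~~ (clash d n c.1 c.2 1 k.+2 || clash d n 1 k.+2 c.1 c.2).
      move=> k0; have := h (seg n 1 k.+2).
      rewrite in_wedge dcompatibleE /seg /= !inordK //; apply.
      by rewrite /is_dchord; lia.
    move: cs h0 h1; rewrite /clash /P /Q => /andP[ns hc]; rewrite hc /= in ns *.
    move: ns; case/or3P: hc => hc; lia.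
  split; first by move: cAB; rewrite /is_dchord /P /Q; lia.
  apply/forall_inP => y; rewrite in_wedge dcompatibleE.
  move: cAB; rewrite /is_dchord /clash /P /Q; lia.
rewrite card_facets_join; first last.
- move=> x y; rewrite !in_set dcompatibleE /P /Q /is_dchord /clash; lia.
- rewrite -setI_eq0; apply/eqP/setP => c; rewrite !in_set /P /Q; lia.
- exact: dcompatible_sym.
- exact: dcompatible_refl.
congr (_ * _).
  case: k kd kn ltk @P @A {Q B cl} => [|k] kd kn _ P A.
    rewrite (_ : A = set0) ?card_facets0 //.
    - exact: dcompatible_refl.
    - exact: dcompatible_sym.
    apply/setP => c; rewrite !in_set /P /is_dchord; lia.
  apply: (@card_facets_relabel d k n P (fun a _ => a.+1) (fun a _ => a.-1) 1).
  - move=> a b; rewrite /is_dchord /P /=; split; lia.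
  - move=> a b; rewrite /is_dchord /P /=; split; lia.
  - move=> a b x y; rewrite /is_dchord /clash /=; lia.
apply: (@card_facets_relabel d (n - k.+1) n Q
  (fun a _ => if a == 0 then 0 else a + k.+1) (fun a _ => a - k.+1) k.+1).
- move=> a b; rewrite /is_dchord /Q /=; case: ifP; split; lia.
- move=> a b; rewrite /is_dchord /Q /=; case: ifP; split; lia.
- move=> a b x y; rewrite /is_dchord /clash /=; case: ifP; case: ifP; lia.
Qed.

(** * The recurrence *)

(** The alternatives exclude each other because two wedges conflict, and
    [(0, k+2)] conflicts with [(1, n+2)] for [k < d].  For existence, take the
    longest segment at the vertex 1. *)
Lemma facet_cases d n (D : {set segment n}) : 0 < d -> 0 < n ->
    D \in facets (@dcompatible d n) (dchords d n) ->
  (right_chord n \in D) + \sum_(k < minn d n) (wedge d n k \subset D) = 1.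
Proof.
move=> d0 n0 fD; have [//||sD cD maxD] := facetsP _ _ _ _ fD.
- exact: dcompatible_refl.
- exact: dcompatible_sym.
have outer k : k < d -> k < n -> seg n 0 k.+2 \in wedge d n k.
  move=> kd kn; rewrite in_wedge /seg /= !inordK /is_dchord; lia.
have inner k : 0 < k -> k < d -> k < n -> seg n 1 k.+2 \in wedge d n k.
  move=> k0 kd kn; rewrite in_wedge /seg /= !inordK /is_dchord; lia.
have [rD|rND] := boolP (right_chord n \in D).
  rewrite big1 // => k _; have := ltn_ord k; rewrite leq_min => /andP[kd kn].
  apply/eqP; rewrite eqb0; apply/negP => /subsetP/(_ _ (outer k kd kn)) oD.
  have := cD _ _ oD rD; rewrite dcompatibleE /seg /= !inordK //; last lia.
  rewrite /clash; lia.
(* [p k]: the segment from 1 to [k+2] is in [D] or is a side. *)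
pose p k := (k < minn d n) && ((k == 0) || (seg n 1 k.+2 \in D)).
have ex_p : exists k, p k by exists 0; rewrite /p leq_min d0 n0.
have p_bnd k : p k -> k <= minn d n by case/andP => /ltnW.
case: (ex_maxnP ex_p p_bnd) => k /andP[ltk pk] max_k.
have := ltk; rewrite leq_min => /andP[kd kn].
have ltk2 : k.+2 < n.+3 by lia.
(* By maximality of [k], nothing in [D] conflicts with [(0, k+2)]. *)
have oD : seg n 0 k.+2 \in D.
  apply: maxD => [|[a b] Dab]; first by have := outer k kd kn; rewrite inE => /andP[].
  have hab : is_dchord d n a b by rewrite -(in_dchords d (a, b)) (subsetP sD).
  rewrite dcompatibleE /seg /= !inordK //; apply/negP => clash_ab.
  have [a_k b_k] : 1 <= a <= k.+1 /\ k.+3 <= b by move: clash_ab; rewrite /clash; lia.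
  have [a_1 | a_2] : a = 1 :> nat \/ 2 <= a by lia.
    have [b_n | b_n] : b = n.+2 :> nat \/ b <= n.+1.
    - by move: hab; rewrite /is_dchord; lia.
    - by case/negP: rND; rewrite /right_chord (seg_val (c := (a, b)) a_1 b_n).
    have : p (b - 2); last by move/max_k; lia.
    have e : b = (b - 2).+2 :> nat by lia.
    rewrite /p leq_min (seg_val (c := (a, b)) a_1 e) Dab orbT andbT.
    by move: hab; rewrite /is_dchord; lia.
  have iD : seg n 1 k.+2 \in D by move: pk => /orP[/eqP k0|//]; exfalso; lia.
  by have := cD _ _ iD Dab; rewrite dcompatibleE /seg /= !inordK // /clash; lia.
have wD : wedge d n k \subset D.
  apply/subsetP => -[a b]; rewrite in_wedge /= => /and3P[hab a1 /eqP b_k].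
  have [a_0 | a_1] : a = 0 :> nat \/ a = 1 :> nat by lia.
    by rewrite -(seg_val (c := (a, b)) a_0 b_k).
  rewrite -(seg_val (c := (a, b)) a_1 b_k); move: pk => /orP[/eqP k0|//].
  by move: hab; rewrite /is_dchord; lia.
rewrite (bigD1 (Ordinal ltk)) //= wD big1 // => j.
rewrite -val_eqE /= => neq_jk; have := ltn_ord j; rewrite leq_min => /andP[jd jn].
apply/eqP; rewrite eqb0; apply/negP => /subsetP wjD.
(* Of two wedges, the inner chord of the wider one crosses the outer chord of
   the other. *)
have [lt_jk | lt_kj] : j < k \/ k < j by lia.
  have iD : seg n 1 k.+2 \in D by move: pk => /orP[/eqP k0|//]; exfalso; lia.
  have := cD _ _ (wjD _ (outer j jd jn)) iD.
  by rewrite dcompatibleE /seg /= !inordK // /clash; lia.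
have j0 : 0 < j by lia.
have := cD _ _ oD (wjD _ (inner j j0 jd jn)).
by rewrite dcompatibleE /seg /= !inordK // /clash; lia.
Qed.

(** Summing [facet_cases] over all facets. *)
Lemma S_num_rec d n : 0 < d -> 0 < n ->
  S_num d n = S_num d n.-1
    + \sum_(k < minn d n) ear_count d k * S_num d (n - k.+1).
Proof.
move=> d0 n0; rewrite [LHS]S_numE -card_facets_right_chord //.
have -> : \sum_(k < minn d n) ear_count d k * S_num d (n - k.+1) =
    \sum_(k < minn d n)
      #|[set D in facets (@dcompatible d n) (dchords d n) | wedge d n k \subset D]|.
  by apply: eq_bigr => k _; have := ltn_ord k; rewrite leq_min => /andP[kd kn];
     rewrite card_facets_wedge.
rewrite -[LHS]sum1_card.
transitivity (\sum_(D in facets (@dcompatible d n) (dchords d n))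
    ((right_chord n \in D) + \sum_(k < minn d n) (wedge d n k \subset D))).
  by apply: eq_bigr => D fD; rewrite facet_cases.
have sum_card (F : {set {set segment n}}) (p : pred {set segment n}) :
    \sum_(D in F) p D = #|[set D in F | p D]|.
  rewrite -sum1_card big_mkcond [RHS]big_mkcond; apply: eq_bigr => D _.
  by rewrite inE; case: (D \in F) => //=; case: (p D).
rewrite big_split /= sum_card; congr (_ + _).
by rewrite exchange_big; apply: eq_bigr => k _; apply: sum_card.
Qed.

(** In this range [minn d n = n], and the recurrence is the convolution above
    with its last term split off: that term is the isolated [S_num d n.-1]. *)
Lemma S_num_catalan d n : 0 < d -> n <= d -> S_num d n = catalan n.+1.
Proof.
move=> d0; elim/ltn_ind: n => -[|n] IHn led; first by [].
have ear k : k <= n.+1 -> ear_count d k = catalan k.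
  by case: k => [|k] // lekn; apply: IHn; lia.
rewrite S_num_rec // (minn_idPr led) IHn //=; last lia.
rewrite -[RHS]catalan_convolution [RHS]big_ord_recr /= subnn addnC muln1; congr (_ + _).
apply: eq_bigr => k _; have := ltn_ord k => ltkn.
rewrite ear; last lia.
by rewrite IHn ?subSS -?subSn; [|lia..].
Qed.

Theorem proposition3p25 (d n : nat) (hd : 1 <= d) (hdn : d <= n) :
  S_num d n =
    2 * S_num d (n - 1) + \sum_(1 <= k < d) catalan k * S_num d (n - k - 1).
Proof.
rewrite S_num_rec //; last lia.
rewrite (minn_idPl hdn) -subn1 mul2n -addnn -addnA; congr (_ + _).
rewrite -(big_mkord xpredT (fun k => ear_count d k * S_num d (n - k.+1))).
rewrite big_ltn // mul1n; congr (_ + _).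
apply: eq_big_nat => -[|k] // /andP[_ ltkd].
by rewrite /= S_num_catalan // ?subn1 ?subnS //; lia.
Qed.
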